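(* Let $n,k,t$ be positive integers with $t\ge n$, $\frac{n(n+1)}{2}=k\cdot t$, $n$ odd and $2k\mid n+1$. The algorithm $\mathtt{meanderodd}(n,k,t)$ (a) outputs sets $T_1,\dots,T_k$ that are pairwise disjoint, whose union is $\{0,1,\dots,n\}$, and with $\sum_{x\in T_j}x=t$ for each $j$ (so they give a $(k,t)$-partition of $\{1,\dots,n\}$ after discarding the element $0$); and (b) needs $\mathcal{O}(n)$ steps to insert the elements into the sets $T_j$.
   Context: $\mathtt{meanderodd}(n,k,t)$: start with $T_j=\emptyset$ for $1\le j\le k$; for $j=1,\dots,k$ and $i=1,\dots,\frac{n+1}{2k}$, insert the element $2ki-j$ and the element $2k(i-1)+(j-1)$ into $T_j$. (The element $0$ is thereby inserted into $T_1$; by convention the ground set is taken to contain $0$.) *)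

(* Defs.v *)
From mathcomp Require Import all_boot finmap.

Set Implicit Arguments.
Unset Strict Implicit.
Unset Printing Implicit Defensive.

(** Unit-cost random access model: every arithmetic operation, every assignment
    of the empty set, every insertion of one element into one set and every test
    of a loop counter is one step. *)

Record timed (A : Type) := Timed { value : A; steps : nat }.

Definition expr := timed nat.

(** Reading a constant or a variable is free. *)
Definition atom (m : nat) : expr := Timed m 0.
Coercion atom : nat >-> expr.

Definition arith (op : nat -> nat -> nat) (x y : expr) : expr :=
  Timed (op (value x) (value y)) (steps x + steps y).+1.

Declare Scope expr_scope.
Delimit Scope expr_scope with E.
Notation "x + y" := (arith addn x%E y%E) : expr_scope.
Notation "x - y" := (arith subn x%E y%E) : expr_scope.
Notation "x * y" := (arith muln x%E y%E) : expr_scope.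
Notation "x %/ y" := (arith divn x%E y%E) : expr_scope.

(** An array of sets; the algorithm only uses the cells [1], ..., [k]. *)
Definition sets := nat -> {fset nat}.

Definition cmd := sets -> timed sets.

Definition clear (j : nat) : cmd := fun T =>
  Timed (fun l => if l == j then fset0 else T l) 1.

Definition insert (x : expr) (j : nat) : cmd := fun T =>
  Timed (fun l => if l == j then (value x |` T l)%fset else T l) (steps x).+1.

Definition andThen (c d : cmd) : cmd := fun T =>
  let r := c T in
  let r' := d (value r) in
  Timed (value r') (steps r + steps r').

(** The counter runs over 1, ..., [hi], both ends included. The bound is evaluated
    once, on entry; the extra step at the start is the test that exits. *)
Definition forTo (hi : expr) (body : nat -> cmd) : cmd := fun T =>
  foldl (fun r i => let r' := body i (value r) in
                    Timed (value r') (steps r + steps r').+1)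
        (Timed T (steps hi).+1) (index_iota 1 (value hi).+1).

Definition meanderodd_cmd (n k t : nat) : cmd :=
  andThen
    (forTo k (fun j => clear j))
    (forTo k (fun j =>
       forTo ((n + 1%N) %/ (2%N * k))%E (fun i =>
         andThen
           (insert (2%N * k * i - j)%E j)
           (insert (2%N * k * (i - 1%N) + (j - 1%N))%E j)))).

Definition meanderodd (n k t : nat) : timed sets :=
  meanderodd_cmd n k t (fun=> fset0).

Definition pairwise_disjoint (k : nat) (T : sets) : Prop :=
  forall i j : nat, 1 <= i <= k -> 1 <= j <= k -> i != j ->
    [disjoint T i & T j]%fset.

Definition kt_partition (n k t : nat) (T : sets) : Prop :=
  [/\ pairwise_disjoint k T,
      (\bigcup_(j <- index_iota 1 k.+1) T j)%fset = [fset x in index_iota 1 n.+1]%fset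
    & forall j : nat, 1 <= j <= k -> \sum_(x <- T j) x = t].

(* Main.v *)
Require Import Defs.
From mathcomp Require Import all_boot finmap.
From mathcomp Require Import zify.

(** The set [T_j] meets each block [[2k(i-1), 2ki)] of the ground set in the two
    elements whose residues modulo [2k] are [j - 1] and [2k - j]. These pairs of
    residues partition [{0, ..., 2k-1}], which gives disjointness and covering,
    and the pair in block [i] has a sum independent of [j]. *)

Lemma forTo0 (s : nat) (body : nat -> cmd) (T : sets) :
  forTo (Timed 0 s) body T = Timed T s.+1.
Proof. by []. Qed.

(** Splitting the bound into value and cost lets induction run on the value while the cost of
    evaluating it stays fixed. *)
Lemma forToS (h s : nat) (body : nat -> cmd) (T : sets) :
  forTo (Timed h.+1 s) body T =
  let r := forTo (Timed h s) body T in
  let r' := body h.+1 (value r) in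
  Timed (value r') (steps r + steps r').+1.
Proof.
by rewrite /forTo /index_iota !subn1 [h.+2.-1]/= -(addn1 h) iotaD foldl_cat /= addn1.
Qed.

Lemma steps_forTo (c h s : nat) (body : nat -> cmd) (T : sets) :
  (forall i T', steps (body i T') = c) ->
  steps (forTo (Timed h s) body T) = s.+1 + h * c.+1.
Proof.
by move=> body_c; elim: h => [|h IHh]; rewrite ?forTo0 ?forToS /= ?IHh ?body_c; lia.
Qed.

(** What [m] rounds of the inner loop put into cell [j], in the same insertion order; [m'] stands
    for [i - 1]. *)
Fixpoint meander_set (k j m : nat) : {fset nat} :=
  if m is m'.+1 then
    ((2 * k * m' + (j - 1))%N |` ((2 * k * m'.+1 - j)%N |` meander_set k j m'))%fset
  else fset0.

Lemma mem_meander_set (k j m x : nat) : 1 <= j <= k ->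
  (x \in meander_set k j m) =
  (x < 2 * k * m) && ((x %% (2 * k) == j - 1) || (x %% (2 * k) == 2 * k - j)).
Proof.
move=> j_k; elim: m => [|m IHm]; first by rewrite muln0 in_fset0.
have k_gt0 : 0 < 2 * k by lia.
have x_div := divn_eq x (2 * k); have x_mod := ltn_pmod x k_gt0.
rewrite /= !in_fset1U {}IHm.
move: (x %/ (2 * k)) (x %% (2 * k)) x_div x_mod => q r -> r_lt.
(* Both new elements have quotient [m] by [2 * k], so membership changes only for [q = m]. The
   product bounds supply the nonlinear facts for [lia]. *)
case: (ltngtP q m) => [q_lt|q_gt|->].
- have q_le : q.+1 * (2 * k) <= m * (2 * k) by rewrite leq_mul2r q_lt orbT.
  lia.
- have q_ge : m.+1 * (2 * k) <= q * (2 * k) by rewrite leq_mul2r q_gt orbT.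
  lia.
- lia.
Qed.

(** The pair added at [m'] sums to [2k(2m' + 1) - 1], where [j] cancels; summing over [m' < m] gives
    [2km^2 - m]. *)
Lemma sum_meander_set (k j m : nat) : 1 <= j <= k ->
  \sum_(x <- meander_set k j m) x = m * (2 * k * m - 1).
Proof.
move=> j_k; elim: m => [|m IHm]; first by rewrite big_seq_fset0.
rewrite /= !big_fsetU1 /= ?in_fset1U ?mem_meander_set ?IHm //; try lia.
(* At [m = 0] the subtraction in [2 * k * m - 1] truncates. *)
by case: m {IHm} => [|m]; nia.
Qed.

Lemma value_inner_loop (k j m s : nat) (T : sets) (l : nat) :
  value (forTo (Timed m s) (fun i =>
    andThen (insert (2%N * k * i - j)%E j)
            (insert (2%N * k * (i - 1%N) + (j - 1%N))%E j)) T) l =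
  if l == j then (meander_set k j m `|` T l)%fset else T l.
Proof.
elim: m => [|m IHm]; first by rewrite forTo0 /= fset0U; case: ifP.
by rewrite forToS /= IHm; case: (l == j) => //; rewrite (subn1 m.+1) !fsetUA.
Qed.

Lemma value_clear_loop (k s : nat) (l : nat) :
  value (forTo (Timed k s) clear (fun=> fset0)) l = fset0.
Proof. by elim: k => [|k IHk] //; rewrite forToS /= IHk; case: ifP. Qed.

(** The loop bound [h] is kept apart from [k], so that induction on it leaves the block length
    [2 * k] unchanged. *)
Lemma value_outer_loop (k m s s' h : nat) (T : sets) (l : nat) :
  value (forTo (Timed h s') (fun j => forTo (Timed m s) (fun i =>
    andThen (insert (2%N * k * i - j)%E j)
            (insert (2%N * k * (i - 1%N) + (j - 1%N))%E j))) T) l =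
  if 1 <= l <= h then (meander_set k l m `|` T l)%fset else T l.
Proof.
elim: h => [|h IHh]; first by rewrite forTo0 /=; case: ifP => //; lia.
rewrite forToS /= value_inner_loop IHh.
case: (l =P h.+1) => [->|l_neq]; first by rewrite ltnn leqnn.
by have -> : (l <= h.+1) = (l <= h) by lia.
Qed.

Lemma value_meanderodd (n k t j : nat) : 1 <= j <= k ->
  value (meanderodd n k t) j = meander_set k j ((n + 1) %/ (2 * k)).
Proof.
move=> j_k; rewrite /meanderodd /meanderodd_cmd /andThen /=.
by rewrite value_outer_loop j_k value_clear_loop fsetU0.
Qed.

(** The two insertions cost 4 and 6, and the loop test makes 11 per inner round. Each inner loop
    adds 3 for its bound and 1 for its exit test. *)
Lemma steps_meanderodd (n k t : nat) :
  steps (meanderodd n k t) = 2 + 7 * k + 11 * (k * ((n + 1) %/ (2 * k))).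
Proof.
rewrite /meanderodd /meanderodd_cmd /andThen /=.
rewrite (@steps_forTo 1) // (@steps_forTo (4 + (n + 1) %/ (2 * k) * 11)); first lia.
by move=> j T; rewrite (@steps_forTo 10).
Qed.

Lemma sum_fsetD0 (A : {fset nat}) : \sum_(x <- (A `\ 0)%fset) x = \sum_(x <- A) x.
Proof.
have [A0|A0] := boolP (0 \in A); first by rewrite (big_fsetD1 0 A0).
by rewrite mem_fsetD1.
Qed.

Theorem theorem2 :
  exists C : nat, forall n k t : nat,
    0 < n -> 0 < k -> 0 < t ->
    n <= t ->
    (n * (n + 1)) %/ 2 = k * t ->
    odd n ->
    2 * k %| n + 1 ->
    let T := value (meanderodd n k t) in
    [/\ pairwise_disjoint k T,
        (\bigcup_(j <- index_iota 1 k.+1) T j)%fset = [fset x in index_iota 0 n.+1]%fset,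
        forall j : nat, 1 <= j <= k -> \sum_(x <- T j) x = t,
        kt_partition n k t (fun j => (T j `\ 0)%fset)
      & steps (meanderodd n k t) <= C * n].
Proof.
(* With [m] blocks, [2km = n + 1] and [k <= km] bound the count by [9n + 11], so 31 is a generous
   choice for [n >= 1]. *)
exists 31 => n k t n_gt0 k_gt0 _ _ sum_eq _ k_dvd T.
have n_eq : n + 1 = 2 * k * ((n + 1) %/ (2 * k)) by rewrite mulnC divnK.
have steps_eq := steps_meanderodd n k t.
have value_eq j : 1 <= j <= k -> T j = meander_set k j ((n + 1) %/ (2 * k)).
  exact: value_meanderodd.
move: ((n + 1) %/ (2 * k)) => m in n_eq steps_eq value_eq.
have m_gt0 : 0 < m by case: m n_eq {steps_eq value_eq} => //; lia.
have t_eq : t = m * n.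
  (* Since [n + 1 = 2km], the halving is exact and yields [kmn]; then [k] cancels. *)
  apply/eqP; rewrite -(eqn_pmul2l k_gt0) -sum_eq n_eq.
  by rewrite (_ : n * (2 * k * m) = k * (m * n) * 2) ?mulnK //; nia.
have memT j x : 1 <= j <= k -> (x \in T j) =
    (x <= n) && ((x %% (2 * k) == j - 1) || (x %% (2 * k) == 2 * k - j)).
  by move=> j_k; rewrite value_eq // mem_meander_set // -n_eq addn1 ltnS.
have disjT : pairwise_disjoint k T.
  (* The residue [j - 1] lies below [k] and [2k - j] does not, so either one determines [j]. *)
  move=> i j i_k j_k ij; apply/fdisjointP => x; rewrite !memT //.
  by move: (x %% _) => r; lia.
have coverT x : x <= n -> exists2 j, 1 <= j <= k & x \in T j.
  move=> x_le; have r_lt : x %% (2 * k) < 2 * k by apply: ltn_pmod; lia.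
  (* A residue [r < k] is [j - 1] for [j = r + 1]; otherwise it is [2k - j] for [j = 2k - r]. *)
  case: (ltnP (x %% (2 * k)) k) => r_k.
    by exists (x %% (2 * k)).+1; rewrite ?memT //; move: (x %% _) r_lt r_k => r; lia.
  exists (2 * k - x %% (2 * k)); rewrite ?memT //;
    by move: (x %% _) r_lt r_k => r; lia.
have sumT j : 1 <= j <= k -> \sum_(x <- T j) x = t.
  by move=> j_k; rewrite value_eq // sum_meander_set // -n_eq addnK t_eq.
split=> //.
- apply/fsetP => x; rewrite in_fset mem_index_iota /= ltnS.
  apply/bigfcupP/idP => [[j]|/coverT[j j_k xT]].
    by rewrite mem_index_iota ltnS andbT => j_k; rewrite memT // => /andP[].
  by exists j => //; rewrite mem_index_iota ltnS j_k.
- split.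
  + move=> i j i_k j_k ij; apply/fdisjointP => x.
    rewrite !in_fsetD1 negb_and => /andP[_ xT]; apply/orP; right.
    by move/fdisjointP: (disjT i j i_k j_k ij); apply.
  + apply/fsetP => x; rewrite in_fset mem_index_iota ltnS.
    apply/bigfcupP/idP => [[j]|/andP[x_gt0 /coverT[j j_k xT]]].
      rewrite mem_index_iota ltnS andbT => j_k; rewrite in_fsetD1 memT //.
      by case/and3P=> x_neq0 -> _; rewrite lt0n x_neq0.
    exists j; first by rewrite mem_index_iota ltnS j_k.
    by rewrite in_fsetD1 -lt0n x_gt0.
  + by move=> j j_k; rewrite sum_fsetD0 sumT.
- have k_le : k <= k * m by rewrite leq_pmulr.
  by rewrite steps_eq; lia.
Qed.
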